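(* Let $N\ge 1$, let $G=[g_{ij}]\in\mathbb{R}^{N\times N}$ satisfy $g_{ii}=0$ for all $i$ and have spectral radius $\rho(G)<1$, let $\alpha\in\mathbb{R}^N$, let $B=\operatorname{diag}(b_1,\dots,b_N)$ with $b_i\in\{0,1\}$, and suppose the pair $(G,B)$ is controllable. Let $\epsilon\in[0,\frac{1}{N+1}]$, let $(v_t)_{t\ge1}$ be independent random vectors with $v_t\sim\mathcal{N}(0,I)$ in $\mathbb{R}^N$ on a probability space $(\Omega,\mathcal F,\mathbb{P})$, and let $u_t=v_t/t^{\epsilon/2}$ for $t\ge 1$, with $u_0\in\mathbb{R}^N$ prescribed. Let $x_0\in\mathbb{R}^N$ and let $(x_t)$ be generated by $x_{t+1}=\alpha+Gx_t+Bu_t$, $t\ge0$. Then there exists $\Omega_0\subseteq\Omega$ with $\mathbb{P}(\Omega_0)=1$ such that for every $\omega\in\Omega_0$ there exists a finite integer $n(\omega)$ such that, for all $n\ge n(\omega)$, the matrix $G$ can be exactly recovered from the first $n$ samples of the trajectory.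
   Context: The pair $(G,B)$ is controllable if $\operatorname{rank}[B,\ GB,\ \dots,\ G^{N-1}B]=N$. The matrix $B$ and the inputs $u_t$ are known, the vectors $x_t$ are observed, and $\alpha$ and $G$ are unknown. ''$G$ can be exactly recovered from the first $n$ samples'' means that $G$ is uniquely determined by the data $x_0,\dots,x_{n+1}$, $u_0,\dots,u_n$ and $B$: whenever $\alpha'\in\mathbb{R}^N$ and $G'\in\mathbb{R}^{N\times N}$ satisfy $x_{t+1}=\alpha'+G'x_t+Bu_t$ for all $t=0,\dots,n$, one has $G'=G$. *)

(* Defs.v *)
From HB Require Import structures.
From mathcomp Require Import all_boot all_order all_algebra finmap.
From mathcomp Require Import all_classical all_reals all_analysis.
From mathcomp Require Import complex.

Set Implicit Arguments.
Unset Strict Implicit.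
Unset Printing Implicit Defensive.

Import Order.TTheory GRing.Theory Num.Theory.
Import numFieldNormedType.Exports.
Local Open Scope classical_set_scope.
Local Open Scope ring_scope.

(* The eigenvalues are those of G over the complex field R[i]. Norms in R[i]
   are complex numbers with zero imaginary part, hence the projection Re. The
   supremum is a maximum over a finite set, which is nonempty when 0 < N. *)
Definition spectral_radius (R : realType) (N : nat) (G : 'M[R]_N) : R :=
  sup [set complex.Re `|l| | l in
    [set l : R[i] | eigenvalue (map_mx (real_complex R) G) l]].

(* \mxrow_(k < N) (G ^+ k *m B) is the block row [B, GB, ..., G^(N-1)B]. *)
Definition controllable (R : realType) (N : nat) (G B : 'M[R]_N) : Prop :=
  \rank (\mxrow_(k < N) (G ^+ k *m B)) = N.

(* Mutual independence of the family (X i) for i in D. *)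
Definition independent_RVs d d' (T : measurableType d) (T' : measurableType d')
    (R : realType) (P : probability T R) (I : choiceType) (D : set I)
    (X : I -> T -> T') : Prop :=
  forall (J : {fset I}) (A : I -> set T'),
    [set` J] `<=` D ->
    (forall i, i \in J -> measurable (A i)) ->
    P (\bigcap_(i in [set` J]) (X i @^-1` A i)) =
    (\prod_(i <- J) P (X i @^-1` A i))%E.

(* X ~ N(0, I): the coordinates of X are mutually independent and each has
   law N(0, 1). Random vectors take values in N.-tuple R, which the library
   equips with the product sigma-algebra (the Borel one on R^N). *)
Definition standard_normal_vector d (T : measurableType d) (R : realType)
    (P : probability T R) (N : nat) (X : {RV P >-> N.-tuple R}) : Prop :=
  (forall (i : 'I_N) (A : set R), measurable A ->
     P ((fun w => tnth (X w) i) @^-1` A) = normal_prob 0 1 A) /\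
  independent_RVs P [set: 'I_N] (fun i w => tnth (X w) i).

Definition col_of_tuple (R : realType) (N : nat) (v : N.-tuple R) : 'cV[R]_N :=
  \col_(i < N) tnth v i.

(* Among all pairs (a', G') consistent with x_0, ..., x_(n+1), u_0, ..., u_n
   and B, the matrix G' is determined; no constraint is put on G'. *)
Definition exactly_recoverable (R : realType) (N : nat) (n : nat)
    (B : 'M[R]_N) (x u : nat -> 'cV[R]_N) (G : 'M[R]_N) : Prop :=
  forall (alpha' : 'cV[R]_N) (G' : 'M[R]_N),
    (forall t : nat, (t <= n)%N ->
       x t.+1 = alpha' + G' *m x t + B *m u t) ->
    G' = G.

(* Main.v *)
Require Import Defs.
From HB Require Import structures.
From mathcomp Require Import all_boot all_order all_algebra finmap.
From mathcomp Require Import all_classical all_reals all_analysis.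

(** Two data-consistent pairs [(alpha, G)] and [(alpha', G')] satisfy
    [(G' - G) x_t = alpha - alpha'] for all observed [t], so [G' - G] kills
    every difference of two observed states.  It is therefore enough that,
    almost surely, [N] differences of states are linearly independent
    ([exactly_recoverable_of_unit]).  The differences used are
    [x_((k+1)N+1) - x_1] for [k < N]; let [M] be the matrix having them as
    columns.

    The first [N^2] random inputs are given by [N^3] independent real normal
    variables, and [det M] is a polynomial function of them, because states are
    affine in the inputs.  This polynomial is not zero: by controllability,
    inputs can be chosen so that the state is displaced from [x_1] by the
    [k]-th basis vector after [(k+1)N] steps, which makes [M] the identity
    ([excursions_identity]).

    A polynomial function that does not vanish identically is almost surely
    nonzero at independent variables whose laws are absolutely continuous
    ([polynomial_zeros_null]).  This is an induction on the number of
    variables: freeze the first one at a value that keeps the polynomial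
    nonzero; outside the null event given by the induction hypothesis, the
    remaining section in the first variable is a nonzero univariate
    polynomial, whose finitely many roots have probability zero, and Fubini
    ([null_of_null_sections]) concludes.

    The excitation may decay at any rate: the factors [t^(eps/2)] only rescale
    the variables by nonzero constants. *)

Set Implicit Arguments.
Unset Strict Implicit.

Import Order.TTheory GRing.Theory Num.Theory.
Import numFieldNormedType.Exports.
Local Open Scope classical_set_scope.
Local Open Scope ring_scope.

(** * Independence and null sets *)

(** Boxes form a pi-system generating the product sigma-algebra. *)
Lemma eq_measure_on_boxes d (T : measurableType d) (R : realType) n
    (m1 m2 : {measure set (n.-tuple T) -> \bar R}) :
  (m1 setT < +oo)%E ->
  (forall A : 'I_n -> set T, (forall i, measurable (A i)) ->
     m1 [set s | forall i, A i (tnth s i)] =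
     m2 [set s | forall i, A i (tnth s i)]) ->
  forall X, measurable X -> m1 X = m2 X.
Proof.
move=> m1oo m12.
pose G := [set X : set (n.-tuple T) | exists2 A : 'I_n -> set T,
  (forall i, measurable (A i)) & X = [set s | forall i, A i (tnth s i)]].
have GT : G setT.
  exists (fun=> setT) => //; exact/seteqP.
apply: (measure_unique G (fun=> setT)) => //; last first.
- by move=> _ [A mA ->]; exact: m12.
- by rewrite bigcup_const.
- move=> _ _ [A mA ->] [A' mA' ->]; exists (fun i => A i `&` A' i).
    by move=> i; exact: measurableI.
  apply/seteqP; split=> [s [sA sA'] i|s sAA']; first by split.
  by split=> i; have [] := sAA' i.
apply/seteqP; split.
- apply: smallest_sub; first exact: smallest_sigma_algebra.
  rewrite -bigcup_seq => X [i _] [A mA <-]; apply: sub_sigma_algebra.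
  exists (fun j => if j == i then A else setT).
    by move=> j; case: ifP.
  apply/seteqP; split=> [s [_ /= sA] j|s /= sA].
    by case: eqP => [->|].
  by split=> //; have := sA i; rewrite eqxx.
- apply: smallest_sub; first exact: sigma_algebra_measurable.
  move=> _ [A mA ->].
  have -> : [set s | forall i, A i (tnth s i)] =
      \bigcap_(i in [set: 'I_n]) ((fun s : n.-tuple T => tnth s i) @^-1` A i).
    by apply/seteqP; split=> [s sA i _|s sA i]; exact: sA.
  apply: fin_bigcap_measurable => // i _.
  by rewrite -[X in measurable X]setTI; exact: measurable_tnth.
Qed.

(** Independence makes the joint law the product of the two laws, so that the
    probability of [E] is the integral of those of its sections. *)
Lemma null_of_null_sections d d1 d2 (Omega : measurableType d)
    (S : measurableType d1) (T : measurableType d2) (R : realType)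
    (P : probability Omega R) (X : {RV P >-> S}) (Y : {RV P >-> T})
    (E : set (S * T)) :
  (forall A B, measurable A -> measurable B ->
     P (X @^-1` A `&` Y @^-1` B) = (P (X @^-1` A) * P (Y @^-1` B))%E) ->
  measurable E -> (forall s, P [set w | E (s, Y w)] = 0%E) ->
  P [set w | E (X w, Y w)] = 0%E.
Proof.
move=> XY mE E0.
have mXY : measurable_fun setT (fun w => (X w, Y w)).
  by apply: measurable_fun_pair.
pose XYm : {mfun Omega >-> (S * T)%type} := HB.pack (fun w => (X w, Y w))
  (isMeasurableFun.Build _ _ _ _ _ mXY).
have -> : P [set w | E (X w, Y w)] = distribution P XYm E by [].
rewrite -(@product_measure_unique _ _ _ _ _ (distribution P X) (distribution P Y)) //.
  by apply: integral0_eq => s _ /=; rewrite /distribution/pushforward xsectionE E0.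
Qed.

(** For a family indexed by all of ['I_n] the product rule for the whole family
    suffices: subfamilies are obtained by taking [A i := setT] elsewhere. *)
Definition mutually_independent d (Omega : measurableType d) (R : realType)
    (P : probability Omega R) n (xi : 'I_n -> Omega -> R) : Prop :=
  forall A : 'I_n -> set R, (forall i, measurable (A i)) ->
    P [set w | forall i, A i (xi i w)] = (\prod_(i < n) P (xi i @^-1` A i))%E.

(** Grouping variables preserves independence.  For fixed [B], both sides are
    finite measures in [A], and the product rule says that they agree on
    boxes. *)
Lemma independent_head_tail d (Omega : measurableType d) (R : realType)
    (P : probability Omega R) n (xi : 'I_n.+1 -> {RV P >-> R})
    (X : {RV P >-> n.-tuple R}) :
  (forall w i, tnth (X w) i = xi (lift ord0 i) w) ->
  mutually_independent P (fun i => xi i : Omega -> R) ->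
  forall A B, measurable A -> measurable B ->
    P (X @^-1` A `&` xi ord0 @^-1` B) =
    (P (X @^-1` A) * P (xi ord0 @^-1` B))%E.
Proof.
move=> Xxi ind A B mA mB.
have mY : measurable (xi ord0 @^-1` B).
  by rewrite -[X in measurable X]setTI; exact: measurable_funP.
pose pB := NngNum (fine_ge0 (measure_ge0 P (xi ord0 @^-1` B))).
have pBE : (pB%:num)%:E = P (xi ord0 @^-1` B).
  by rewrite /= fineK // fin_num_measure.
(* Both sides as measures in A; m2 is the law of X scaled by P (xi ord0 \in B). *)
pose m1 := pushforward (mrestr P mY) X.
pose m2 := mscale pB (distribution P X).
suff -> : P (X @^-1` A `&` xi ord0 @^-1` B) = m2 A.
  by rewrite /m2 /mscale /= pBE muleC.
have := @eq_measure_on_boxes _ _ _ _ m1 m2.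
rewrite /m1 /m2 /mscale /pushforward/= /mrestr; apply => //.
  by rewrite /pushforward preimage_setT setTI (le_lt_trans (probability_le1 _ _)) // ltry.
move=> C mC; rewrite /mscale pBE /distribution /pushforward.
(* The box C on the tail variables, completed by b on the head variable. *)
pose D (b : set R) (i : 'I_n.+1) := oapp C b (unlift ord0 i).
have mD b : measurable b -> forall i, measurable (D b i).
  by move=> mb i; rewrite /D; case: unliftP => [j _|_] /=; first exact: mC.
have DE b w : (forall i, D b i (xi i w)) <->
    (forall i, C i (tnth (X w) i)) /\ b (xi ord0 w).
  split=> [H|[H1 H2] i].
    split=> [i|]; last by have := H ord0; rewrite /D unlift_none.
    by have := H (lift ord0 i); rewrite /D liftK Xxi.
  by rewrite /D; case: unliftP => [j ->|->] //=; rewrite -Xxi.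
have PD b : measurable b ->
    P [set w | (forall i, C i (tnth (X w) i)) /\ b (xi ord0 w)] =
    (P (xi ord0 @^-1` b) *
      \prod_(i < n) P (xi (lift ord0 i) @^-1` C i))%E.
  move=> mb.
  rewrite (_ : [set w | _] = [set w | forall i, D b i (xi i w)]); last first.
    by apply/seteqP; split=> w /DE.
  rewrite ind; last exact: mD.
  rewrite big_ord_recl /D unlift_none; congr (_ * _)%E.
  by apply: eq_bigr => i _; rewrite liftK.
apply: etrans (PD B mB) _; congr (_ * _)%E.
have := PD setT measurableT; rewrite preimage_setT probability_setT mul1e => <- /=.
by congr (P _); apply/seteqP; split=> w // [].
Qed.

(** * Zeros of polynomial functions of random variables *)

(** Polynomial functions are generated inductively, and not given by formal
    multivariate polynomials, so that measurability and the restriction to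
    fewer variables follow by induction on the generation. *)
Inductive polynomial_fun (R : nzRingType) (n : nat) : (n.-tuple R -> R) -> Prop :=
| polyf_const c : polynomial_fun (fun=> c)
| polyf_coord i : polynomial_fun (fun s => tnth s i)
| polyf_add f g : polynomial_fun f -> polynomial_fun g ->
    polynomial_fun (fun s => f s + g s)
| polyf_mul f g : polynomial_fun f -> polynomial_fun g ->
    polynomial_fun (fun s => f s * g s).

Lemma polyf_sum (R : nzRingType) n (I : Type) (r : seq I) (p : pred I)
    (F : I -> n.-tuple R -> R) :
  (forall i, polynomial_fun (F i)) ->
  polynomial_fun (fun s => \sum_(i <- r | p i) F i s).
Proof.
move=> pF; elim: r => [|i r IHr].
  by under eq_fun do rewrite big_nil; exact: polyf_const.
under eq_fun do rewrite big_cons.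
by case: (p i) => //; exact: polyf_add.
Qed.

Lemma polyf_prod (R : nzRingType) n (I : Type) (r : seq I) (p : pred I)
    (F : I -> n.-tuple R -> R) :
  (forall i, polynomial_fun (F i)) ->
  polynomial_fun (fun s => \prod_(i <- r | p i) F i s).
Proof.
move=> pF; elim: r => [|i r IHr].
  by under eq_fun do rewrite big_nil; exact: polyf_const.
under eq_fun do rewrite big_cons.
by case: (p i) => //; exact: polyf_mul.
Qed.

Lemma polyf_det (R : comNzRingType) n m (M : n.-tuple R -> 'M[R]_m) :
  (forall i j, polynomial_fun (fun s => M s i j)) ->
  polynomial_fun (fun s => \det (M s)).
Proof.
move=> pM; apply: polyf_sum => sigma.
by apply: polyf_mul; [exact: polyf_const|exact: polyf_prod].
Qed.

Lemma polyf_measurable (R : realType) n (f : n.-tuple R -> R) :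
  polynomial_fun f -> measurable_fun setT f.
Proof.
elim=> [c|i|{}f g _ mf _ mg|{}f g _ mf _ mg].
- exact: measurable_cst.
- exact: measurable_tnth.
- exact: measurable_realfun.measurable_funD.
- exact: measurable_realfun.measurable_funM.
Qed.

Lemma polyf_fix_head (R : nzRingType) n (f : n.+1.-tuple R -> R) y :
  polynomial_fun f -> polynomial_fun (fun s : n.-tuple R => f [tuple of y :: s]).
Proof.
elim=> [c|i|{}f g _ pf _ pg|{}f g _ pf _ pg].
- exact: polyf_const.
- case: (unliftP ord0 i) => [j ->|->]; last exact: polyf_const.
  by under eq_fun do rewrite tnthS; exact: polyf_coord.
- exact: polyf_add.
- exact: polyf_mul.
Qed.

Lemma polyf_head (R : comNzRingType) n (f : n.+1.-tuple R -> R) (s : n.-tuple R) :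
  polynomial_fun f -> exists p : {poly R}, forall y, f [tuple of y :: s] = p.[y].
Proof.
elim=> [c|i|{}f g _ [p fp] _ [q gq]|{}f g _ [p fp] _ [q gq]].
- by exists c%:P => y; rewrite hornerC.
- case: (unliftP ord0 i) => [j ->|->].
  + by exists (tnth s j)%:P => y; rewrite hornerC tnthS.
  + by exists 'X => y; rewrite hornerX.
- by exists (p + q) => y; rewrite hornerD fp gq.
- by exists (p * q) => y; rewrite hornerM fp gq.
Qed.

Lemma finite_roots (R : idomainType) (p : {poly R}) :
  p != 0 -> finite_set [set y | root p y].
Proof.
move=> p0; apply: contrapT => /(infinite_set_fset (size p)) [B Bp].
apply/negP; rewrite -ltnNge; apply: max_poly_roots => //.
  by apply/allP => y yB; exact: Bp.
exact: fset_uniq.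
Qed.

(** Induction on [n], freezing the first variable at its value [y0] in a point
    where [f] does not vanish.  The zeros of [f] are covered by those of
    [g := f (y0, _)], null by induction, and by the set [E] of the zeros of [f]
    at which [g] does not vanish, all sections of which are finite. *)
Lemma polynomial_zeros_null d (Omega : measurableType d) (R : realType)
    (P : probability Omega R) n (xi : 'I_n -> {RV P >-> R})
    (f : n.-tuple R -> R) :
  mutually_independent P (fun i => xi i : Omega -> R) ->
  (forall i A, measurable A -> lebesgue_measure A = 0%E ->
     P (xi i @^-1` A) = 0%E) ->
  polynomial_fun f -> (exists s, f s != 0) ->
  P [set w | f [tuple xi i w | i < n] = 0] = 0%E.
Proof.
elim: n => [|n IHn] in xi f * => ind ac pf [s0 fs0].
  rewrite (_ : [set w | _] = set0) ?measure0 //.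
  apply/seteqP; split=> // w /=.
  by rewrite (tuple0 [tuple _ | _ < 0]) -(tuple0 s0); exact/eqP.
pose eta (i : 'I_n) := xi (lift ord0 i).
have mX : measurable_fun setT (fun w => [tuple eta i w | i < n]).
  apply/measurable_fun_tnthP => i.
  rewrite (_ : _ \o _ = eta i :> (Omega -> R)); last first.
    by apply/funext => w /=; rewrite tnth_mktuple.
  exact: measurable_funP.
pose X : {RV P >-> n.-tuple R} := HB.pack (fun w => [tuple eta i w | i < n])
  (isMeasurableFun.Build _ _ _ _ _ mX).
have Xeta w i : tnth (X w) i = eta i w by rewrite tnth_mktuple.
have XE w : [tuple xi i w | i < n.+1] = [tuple of xi ord0 w :: X w].
  apply: eq_from_tnth => i; rewrite tnth_mktuple.
  by case: (unliftP ord0 i) => [j ->|-> //]; rewrite tnthS Xeta.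
pose y0 := thead s0; pose g (s : n.-tuple R) := f [tuple of y0 :: s].
have pg : polynomial_fun g by exact: polyf_fix_head.
have gs0 : g [tuple of behead s0] != 0 by rewrite /g -tuple_eta.
have indeta : mutually_independent P (fun i => eta i : Omega -> R).
  move=> A mA.
  pose A' i := oapp A setT (unlift ord0 i).
  rewrite (_ : [set w | _] = [set w | forall i, A' i (xi i w)]); last first.
    apply/seteqP; split=> w /= H i.
      by rewrite /A'; case: unliftP => [j ->|] //=; exact: H.
    by have := H (lift ord0 i); rewrite /A' liftK.
  rewrite ind; last first.
    by move=> i; rewrite /A'; case: unliftP => [j _|_] /=; first exact: mA.
  rewrite big_ord_recl /A' unlift_none /= preimage_setT probability_setT mul1e.
  by apply: eq_bigr => i _; rewrite liftK.
have g0 : P [set w | g (X w) = 0] = 0%E.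
  apply: IHn => //; first by move=> i; exact: ac.
  by exists [tuple of behead s0].
pose E : set (n.-tuple R * R) :=
  [set sy | g sy.1 != 0 /\ f [tuple of sy.2 :: sy.1] = 0].
have mE : measurable E.
  have mfst : measurable_fun setT (fun sy : n.-tuple R * R => g sy.1).
    by apply: measurableT_comp => //; exact: polyf_measurable.
  have mf : measurable_fun setT
      (fun sy : n.-tuple R * R => f [tuple of sy.2 :: sy.1]).
    by apply: measurableT_comp; [exact: polyf_measurable|exact: measurable_cons].
  have -> : E = (fun sy : n.-tuple R * R => g sy.1) @^-1` (~` [set 0]) `&`
      (fun sy : n.-tuple R * R => f [tuple of sy.2 :: sy.1]) @^-1` [set 0].
    by apply/seteqP; split=> -[s y] [/= /eqP].
  by apply: measurableI; rewrite -[X in measurable X]setTI;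
    [apply: mfst => //; exact: measurableC|exact: mf].
have E0 : P [set w | E (X w, xi ord0 w)] = 0%E.
  apply: null_of_null_sections => //; first exact: independent_head_tail.
  move=> s; have [gs|gs] := eqVneq (g s) 0.
    rewrite (_ : [set w | _] = set0) ?measure0 //.
    by apply/seteqP; split=> // w [/=]; rewrite gs eqxx.
  have [p fp] := polyf_head s pf.
  have p0 : p != 0.
    by apply: contraNneq gs => p0; rewrite /g fp p0 horner0.
  rewrite (_ : [set w | _] = xi ord0 @^-1` [set y | root p y]); last first.
    apply/seteqP; split=> w /=; first by case=> _ /= fw; apply/rootP; rewrite -fp.
    by move=> /rootP py; split=> //=; rewrite fp.
  have cp : countable [set y | root p y].
    exact/finite_set_countable/finite_roots.
  apply: ac; first exact: countable_measurable.
  exact: countable_lebesgue_measure0.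
have mg0 : measurable [set w | g (X w) = 0].
  rewrite -[X in measurable X]setTI.
  by apply: (measurableT_comp (polyf_measurable pg) mX _ (measurable_set1 0)).
have mE0 : measurable [set w | E (X w, xi ord0 w)].
  rewrite -[X in measurable X]setTI.
  by apply: (measurable_fun_pair mX (measurable_funPT (xi ord0))).
apply: (@subset_measure0 _ _ _ P _
    ([set w | g (X w) = 0] `|` [set w | E (X w, xi ord0 w)])) => //.
- rewrite -[X in measurable X]setTI.
  have mXX : measurable_fun setT (fun w => [tuple xi i w | i < n.+1]).
    by under eq_fun do rewrite XE; exact: measurable_cons.
  by apply: (measurableT_comp (polyf_measurable pf) mXX _ (measurable_set1 0)).
- exact: measurableU.
- move=> w /=; rewrite XE => fw; have [|gw] := eqVneq (g (X w)) 0; first by left.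
  by right.
- exact: etrans (measureU0 mg0 mE0 E0) g0.
Qed.

(** * Gaussian noise as a family of real variables *)

(** Passes from independence stated with finite sets of indices to products
    over ['I_n]. *)
Lemma independent_RVs_ord d d' (Omega : measurableType d)
    (S : measurableType d') (R : realType) (P : probability Omega R)
    (I : choiceType) (D : set I) (X : I -> Omega -> S) n (h : 'I_n -> I)
    (A : 'I_n -> set S) :
  independent_RVs P D X -> injective h -> (forall i, D (h i)) ->
  (forall i, measurable (A i)) ->
  P [set w | forall i, A i (X (h i) w)] =
  (\prod_(i < n) P (X (h i) @^-1` A i))%E.
Proof.
move=> ind inj_h Dh mA.
pose J := [fset h i | i in 'I_n]%fset.
pose A' j := if [pick i | h i == j] is Some i then A i else setT.
have A'h i : A' (h i) = A i.
  by rewrite /A'; case: pickP => [j /eqP/inj_h ->|/(_ i)/eqP].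
have := ind J A'; rewrite [in X in _ -> _ -> _ = X]big_imfset /=; last first.
  by move=> i j _ _; exact: inj_h.
rewrite big_enum /=; under [in X in _ -> _ -> _ = X]eq_bigr do rewrite A'h.
move=> <-.
- congr (P _); apply/seteqP; split=> w /= H.
    by move=> _ /imfsetP[i _ ->]; rewrite A'h; exact: H.
  by move=> i; rewrite -A'h; apply: H; apply/imfsetP; exists i.
- by move=> _ /imfsetP[i _ ->]; exact: Dh.
- by move=> i _; rewrite /A'; case: pickP => [j _|_]; [exact: mA|].
Qed.

(** The coordinates of [v 1], ..., [v T] as one family of real variables; the
    shift reflects that the input at time 0 is not random. *)
Definition noise (R : realType) (Omega : Type) N T
    (v : nat -> Omega -> N.-tuple R) (k : 'I_(T * N)) (w : Omega) : R :=
  mxvec (\matrix_(t < T, i < N) tnth (v t.+1 w) i) 0 k.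

(** Two-level independence, in time and then between coordinates of one
    vector, flattens to independence of all the coordinates. *)
Lemma noise_independent d (Omega : measurableType d) (R : realType)
    (P : probability Omega R) N T (v : nat -> {RV P >-> N.-tuple R}) :
  (forall t : nat, (1 <= t)%N -> standard_normal_vector (v t)) ->
  independent_RVs P [set t : nat | (1 <= t)%N]
    (fun t => (v t : Omega -> N.-tuple R)) ->
  mutually_independent P
    (@noise R Omega N T (fun t => v t : Omega -> N.-tuple R)).
Proof.
move=> normal ind A mA.
pose C (t : 'I_T) : set (N.-tuple R) :=
  [set s | forall i, A (mxvec_index t i) (tnth s i)].
have mC t : measurable (C t).
  have -> : C t = \bigcap_(i in [set: 'I_N])
      ((fun s : N.-tuple R => tnth s i) @^-1` A (mxvec_index t i)).
    by apply/seteqP; split=> [s sA i _|s sA i]; exact: sA.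
  apply: fin_bigcap_measurable => // i _.
  by rewrite -[X in measurable X]setTI; exact: measurable_tnth.
rewrite (_ : [set w | _] = [set w | forall t, C t (v t.+1 w)]); last first.
  apply/seteqP; split=> w H.
    by move=> t i; have := H (mxvec_index t i); rewrite /noise mxvecE mxE.
  by move=> k; case/mxvec_indexP: k => t i; rewrite /noise mxvecE mxE; exact: H.
rewrite (independent_RVs_ord (h := fun t : 'I_T => t.+1) ind) //; last first.
  by move=> t t' [] /val_inj.
rewrite (reindex _ (curry_mxvec_bij _ _)) /=.
transitivity (\prod_(t < T) \prod_(i < N)
    P (@noise R Omega N T v (mxvec_index t i) @^-1` A (mxvec_index t i)))%E;
  last by rewrite pair_bigA; apply: eq_bigr => -[].
apply: eq_bigr => t _.
have [_ indt] := normal t.+1 isT.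
have -> : v t.+1 @^-1` C t =
  [set w | forall i, A (mxvec_index t i) (tnth (v t.+1 w) i)] by [].
rewrite (independent_RVs_ord (h := fun i : 'I_N => i)
  (A := fun i => A (mxvec_index t i)) indt) //.
apply: eq_bigr => i _; congr (P _); apply/seteqP.
by split=> w; rewrite /preimage /= /noise mxvecE mxE.
Qed.

Lemma noise_law d (Omega : measurableType d) (R : realType)
    (P : probability Omega R) N T (v : nat -> {RV P >-> N.-tuple R}) :
  (forall t : nat, (1 <= t)%N -> standard_normal_vector (v t)) ->
  forall k (A : set R), measurable A ->
  P (@noise R Omega N T (fun t => v t : Omega -> N.-tuple R) k @^-1` A) =
  normal_prob 0 1 A.
Proof.
move=> normal k A mA; case/mxvec_indexP: k => t i.
have [law _] := normal t.+1 isT; rewrite -(law i) //.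
by congr (P _); apply/seteqP; split=> w; rewrite /preimage /= /noise mxvecE mxE.
Qed.

Lemma noise_measurable d (Omega : measurableType d) (R : realType) N T
    (v : nat -> {mfun Omega >-> N.-tuple R}) (k : 'I_(T * N)) :
  measurable_fun setT (noise (fun t => v t : Omega -> N.-tuple R) k).
Proof.
case/mxvec_indexP: k => t i.
rewrite (_ : noise _ _ = (fun s => tnth s i) \o v t.+1); last first.
  by apply/funext => w; rewrite /noise mxvecE mxE.
by apply: measurableT_comp => //; exact: measurable_tnth.
Qed.

(** * Controlled affine dynamics *)

Fixpoint state (R : nzRingType) N (alpha : 'cV[R]_N) (G B : 'M[R]_N)
    (y : 'cV[R]_N) (U : nat -> 'cV[R]_N) (t : nat) : 'cV[R]_N :=
  if t is t'.+1 then alpha + G *m state alpha G B y U t' + B *m U t' else y.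

Lemma state_closed_form (R : nzRingType) N (alpha : 'cV[R]_N) (G B : 'M[R]_N) y U n :
  state alpha G B y U n =
  G ^+ n *m y + \sum_(k < n) G ^+ k *m (alpha + B *m U (n - k.+1)%N).
Proof.
elim: n => [|n IHn] /=; first by rewrite big_ord0 addr0 expr0 mul1mx.
rewrite IHn big_ord_recl expr0 mul1mx subSS subn0 /= mulmxDr mulmxA exprS -mulmxE.
rewrite mulmx_sumr.
under [in RHS]eq_bigr => k _ do
  rewrite /bump /= add1n subSS exprS -mulmxE -mulmxA.
rewrite -!addrA addrC -!addrA; congr (_ + _).
by rewrite addrCA [RHS]addrCA; congr (_ + _); rewrite addrC.
Qed.

Lemma state_add (R : nzRingType) N (alpha : 'cV[R]_N) (G B : 'M[R]_N) y U m n :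
  state alpha G B y U (m + n) =
  state alpha G B (state alpha G B y U m) (fun t => U (m + t)%N) n.
Proof. by elim: n => [|n IHn]; rewrite ?addn0 // addnS /= IHn. Qed.

Lemma eq_state (R : nzRingType) N (alpha : 'cV[R]_N) (G B : 'M[R]_N) y U V n :
  (forall t, (t < n)%N -> U t = V t) ->
  state alpha G B y U n = state alpha G B y V n.
Proof.
elim: n => //= n IHn UV; rewrite IHn ?UV // => t tn.
by apply: UV; exact: ltnW.
Qed.

(** The state after [N] steps is an affine function of the [N] inputs, with
    linear part the controllability matrix (the last input being multiplied
    by [B], the first one by [G ^+ N.-1 *m B]); full row rank gives that matrix
    a right inverse [D], which yields the inputs. *)
Lemma controllable_steer (R : realType) N (alpha : 'cV[R]_N) (G B : 'M[R]_N) :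
  controllable G B ->
  forall y z, exists U, state alpha G B y U N = z.
Proof.
move=> ctrl y z.
have /row_freeP[D CD] : row_free (\mxrow_(k < N) (G ^+ k *m B)).
  by rewrite /row_free ctrl.
pose r := z - G ^+ N *m y - \sum_(k < N) G ^+ k *m alpha.
pose W (k : 'I_N) : 'cV[R]_N := submxcol (D *m r) k.
exists (fun t => if insub (N - t.+1)%N is Some k then W k else 0).
rewrite state_closed_form.
under eq_bigr => k _.
  rewrite mulmxDr (_ : (N - (N - k.+1).+1)%N = k); last first.
    by rewrite subnSK // subKn // ltnW.
  rewrite valK mulmxA; over.
rewrite big_split /= -(mul_mxrow_mxcol _ W) submxcolK mulmxA CD mul1mx.
rewrite /r; set a := G ^+ N *m y; set c := \sum_(_ < _) _.
by rewrite [c + _]addrC subrK addrC subrK.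
Qed.

(** Concatenates steering segments of length [N]. *)
Lemma controllable_visit (R : realType) N (alpha : 'cV[R]_N) (G B : 'M[R]_N) :
  (0 < N)%N -> controllable G B ->
  forall z : nat -> 'cV[R]_N,
  exists U, forall k, state alpha G B (z 0%N) U (k * N) = z k.
Proof.
move=> N0 /(controllable_steer alpha) steer z.
have /choice[W HW] : forall k, exists U, state alpha G B (z k) U N = z k.+1.
  by move=> k; exact: steer.
exists (fun t => W (t %/ N)%N (t %% N)%N); elim=> [//|k IHk].
rewrite mulSnr state_add IHk -[RHS]HW; apply: eq_state => t tN.
by rewrite divnMDl // divn_small // addn0 modnMDl modn_small.
Qed.

Lemma state_polynomial (R : comNzRingType) N n (alpha : 'cV[R]_N)
    (G B : 'M[R]_N) (y : 'cV[R]_N) (U : n.-tuple R -> nat -> 'cV[R]_N) :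
  (forall t i, polynomial_fun (fun s => U s t i 0)) ->
  forall t i, polynomial_fun (fun s => state alpha G B y (U s) t i 0).
Proof.
move=> pU; elim=> [|t IHt] i /=; first exact: polyf_const.
under eq_fun do rewrite !mxE.
apply: polyf_add; first apply: polyf_add; first exact: polyf_const.
  by apply: polyf_sum => j; apply: polyf_mul; [exact: polyf_const|].
by apply: polyf_sum => j; apply: polyf_mul; [exact: polyf_const|].
Qed.

(** The scaled input vectors as functions of the flattened noise, [drive c s t]
    being the input at time [t.+1].  The value 0 for [t >= T] is a placeholder:
    only the first [T] inputs matter. *)
Definition drive (R : nzRingType) N T (c : nat -> R) (s : (T * N).-tuple R)
    (t : nat) : 'cV[R]_N :=
  if insub t is Some t' then
    c t *: \col_(i < N) tnth s (mxvec_index (t' : 'I_T) i)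
  else 0.

Lemma drive_polynomial (R : comNzRingType) N T (c : nat -> R) t i :
  polynomial_fun (fun s : (T * N).-tuple R => drive c s t i 0).
Proof.
rewrite /drive; case: insubP => [t' _ _|_].
  under eq_fun do rewrite !mxE.
  by apply: polyf_mul; [exact: polyf_const|exact: polyf_coord].
by under eq_fun do rewrite mxE; exact: polyf_const.
Qed.

Lemma drive_surj (R : fieldType) N T (c : nat -> R) (U : nat -> 'cV[R]_N) :
  (forall t, c t != 0) ->
  exists s : (T * N).-tuple R, forall t, (t < T)%N -> drive c s t = U t.
Proof.
move=> c0.
exists [tuple mxvec (\matrix_(t < T, i < N) ((c t)^-1 *: U t) i 0) 0 k | k < T * N].
move=> t tT; rewrite /drive insubT /=; apply/colP => i.
by rewrite !mxE tnth_mktuple mxvecE !mxE mulVKf.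
Qed.

(** Inputs exist for which the state sits at [y] plus the [k]-th basis vector
    after [(k+1)N] steps. *)
Lemma excursions_identity (R : realType) N (alpha : 'cV[R]_N)
    (G B : 'M[R]_N) (y : 'cV[R]_N) (c : nat -> R) :
  (0 < N)%N -> controllable G B -> (forall t, c t != 0) ->
  exists s : (N * N * N).-tuple R,
    \matrix_(i < N, k < N) (state alpha G B y (drive c s) (k.+1 * N) - y) i 0 =
    1%:M.
Proof.
move=> N0 ctrl c0.
pose z k : 'cV[R]_N :=
  if k is k'.+1 then y + \col_i (i == k' :> nat)%:R else y.
have [U HU] := controllable_visit alpha N0 ctrl z.
have [s Hs] := drive_surj (N * N) U c0.
exists s; apply/matrixP => i k.
rewrite mxE (@eq_state _ _ _ _ _ _ _ U); last first.
  by move=> t tk; apply: Hs; rewrite (leq_trans tk) // leq_mul2r ltn_ord orbT.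
by rewrite -/(z 0) HU /= addrC addKr !mxE.
Qed.

(** * Recovery of the transition matrix *)

(** [G' - G] takes the same value on all the observed states, hence vanishes on
    the columns of the invertible matrix of their differences. *)
Lemma exactly_recoverable_of_unit (R : realType) N n (alpha : 'cV[R]_N)
    (G B : 'M[R]_N) (x u : nat -> 'cV[R]_N) (t0 : nat) (t : 'I_N -> nat) :
  (forall k, x k.+1 = alpha + G *m x k + B *m u k) ->
  (t0 <= n)%N -> (forall k, t k <= n)%N ->
  \matrix_(i, k) (x (t k) - x t0) i 0 \in unitmx ->
  exactly_recoverable n B x u G.
Proof.
move=> dyn t0n tn; set M := (\matrix_(i, k) _) => unitM alpha' G' dyn'.
have aff k : (k <= n)%N -> (G' - G) *m x k = alpha - alpha'.
  move=> kn; have := dyn' k kn; rewrite dyn => /addIr E.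
  by rewrite mulmxBl; apply/eqP; rewrite subr_eq addrAC E addrC addKr.
apply/eqP; rewrite -subr_eq0; apply/eqP; rewrite -[G' - G](mulmxK unitM).
suff -> : (G' - G) *m M = 0 by rewrite mul0mx.
apply/matrixP => i k.
transitivity (((G' - G) *m (x (t k) - x t0)) i 0).
  by rewrite !mxE; apply: eq_bigr => j _; rewrite !mxE.
by rewrite mulmxBr !aff // subrr !mxE.
Qed.

Unset Implicit Arguments.

Theorem theorem2 (R : realType) (N : nat) (hN : (1 <= N)%N)
  (G : 'M[R]_N)
  (hGdiag : forall i : 'I_N, G i i = 0)
  (hGrho : spectral_radius G < 1)
  (alpha : 'cV[R]_N)
  (b : 'rV[R]_N)
  (hb : forall i : 'I_N, b 0 i = 0 \/ b 0 i = 1)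
  (B : 'M[R]_N) (hB : B = diag_mx b)
  (hctrl : controllable G B)
  (eps : R) (heps0 : 0 <= eps) (heps1 : eps <= 1 / N.+1%:R)
  (d : measure_display) (Omega : measurableType d) (P : probability Omega R)
  (v : nat -> {RV P >-> N.-tuple R})
  (hvnormal : forall t : nat, (1 <= t)%N -> standard_normal_vector (v t))
  (hvindep : independent_RVs P [set t : nat | (1 <= t)%N]
               (fun t => (v t : Omega -> N.-tuple R)))
  (u0 : 'cV[R]_N)
  (u : nat -> Omega -> 'cV[R]_N)
  (hu0 : forall w : Omega, u 0%N w = u0)
  (hu : forall (t : nat) (w : Omega), (1 <= t)%N ->
     u t w = (t%:R `^ (eps / 2))^-1 *: col_of_tuple (v t w))
  (x0 : 'cV[R]_N)
  (x : nat -> Omega -> 'cV[R]_N)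
  (hx0 : forall w : Omega, x 0%N w = x0)
  (hx : forall (t : nat) (w : Omega),
     x t.+1 w = alpha + G *m x t w + B *m u t w) :
  exists Omega0 : set Omega,
    [/\ measurable Omega0, P Omega0 = 1%E &
      forall w : Omega, Omega0 w ->
        exists n0 : nat, forall n : nat, (n0 <= n)%N ->
          exactly_recoverable n B (fun t => x t w) (fun t => u t w) G].
Proof.
have law0 k (A : set R) : measurable A -> lebesgue_measure A = 0%E ->
    P (noise (T := N * N) v k @^-1` A) = 0%E.
  move=> mA A0; rewrite noise_law //.
  have /null_content_dominatesP := @normal_prob_dominates R 0 1.
  exact.
pose xi (k : 'I_(N * N * N)) : {RV P >-> R} := HB.pack (noise v k)
  (isMeasurableFun.Build _ _ _ _ _ (noise_measurable v k)).
pose c (t : nat) : R := (t.+1%:R `^ (eps / 2))^-1.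
have c0 t : c t != 0 by rewrite invr_neq0 // gt_eqF // powR_gt0.
(* The last state that the random inputs do not influence. *)
pose x1 := alpha + G *m x0 + B *m u0.
pose M (s : (N * N * N).-tuple R) := \matrix_(i < N, k < N)
  (state alpha G B x1 (drive c s) (k.+1 * N) - x1) i 0.
have pM : polynomial_fun (fun s => \det (M s)).
  apply: polyf_det => i k; under eq_fun do rewrite !mxE.
  apply: polyf_add; last exact: polyf_const.
  by apply: state_polynomial => t j; exact: drive_polynomial.
have M0 : exists s, \det (M s) != 0.
  have [s Ms] := excursions_identity alpha x1 hN hctrl c0.
  by exists s; rewrite /M Ms det1 oner_neq0.
have null := polynomial_zeros_null (xi := xi) (noise_independent hvnormal hvindep)
  law0 pM M0.
pose X w := [tuple xi k w | k < N * N * N].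
have stateE w t : (t <= N * N)%N ->
    state alpha G B x1 (drive c (X w)) t = x t.+1 w.
  elim: t => [_|t IHt tN] /=; first by rewrite hx hx0 hu0.
  rewrite IHt ?(ltnW tN) // [RHS]hx hu //; congr (_ + _ *m _).
  rewrite /drive insubT /=; congr (_ *: _); apply/colP => i.
  by rewrite !mxE tnth_mktuple /= /noise mxvecE mxE.
have mM : measurable [set w | \det (M (X w)) = 0].
  have mX : measurable_fun setT X.
    apply/measurable_fun_tnthP => k.
    rewrite (_ : _ \o _ = xi k :> (Omega -> R)); last first.
      by apply/funext => w /=; rewrite tnth_mktuple.
    exact: measurable_funP.
  rewrite -[X in measurable X]setTI.
  by apply: (measurableT_comp (polyf_measurable pM) mX _ (measurable_set1 0)).
exists (~` [set w | \det (M (X w)) = 0]); split.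
- exact: measurableC.
- by rewrite probability_setC // null sube0.
- move=> w /eqP detM; exists (N * N).+1 => n Nn.
  apply: (exactly_recoverable_of_unit (alpha := alpha) (t0 := 1)
    (t := fun k : 'I_N => (k.+1 * N).+1)).
  + by move=> k; exact: hx.
  + exact: leq_trans Nn.
  + by move=> k; rewrite (leq_trans _ Nn) // ltnS leq_mul2r ltn_ord orbT.
  + rewrite unitmxE unitfE (_ : \matrix_(_, _) _ = M (X w)) //.
    apply/matrixP => i k; rewrite !mxE -stateE.
      by rewrite hx hx0 hu0 !mxE.
    by rewrite leq_mul2r ltn_ord orbT.
Qed.
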